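(* Let $f:[a,b]\to\mathbb{R}$ be a continuous $\Phi$-monotone function. Then for any $n\in\mathbb{N}$ which is a multiple of $3$, $$f(a)-\frac{n}{2}\Phi\Big(\frac{b-a}{n}\Big)\leq\frac{1}{b-a}\mathcal{S}_{n}^{\frac{3}{8}}(f)\leq f(b)+\frac{n}{2}\Phi\Big(\frac{b-a}{n}\Big).$$
   Context: Let $a<b$ be real numbers. $\mathbb{N}$ denotes the set of positive integers and $\mathbb{R}_+$ the set of nonnegative reals. $\Phi:[0,b-a]\to\mathbb{R}_+$ is an arbitrary function (called the error function). A function $f:[a,b]\to\mathbb{R}$ is $\Phi$-monotone if $f(x)\leq f(y)+\Phi(y-x)$ for all $x,y\in[a,b]$ with $x<y$. For $n\in\mathbb{N}$ put $x_i=a+\frac{(b-a)i}{n}$, $i=0,1,\ldots,n$. For $n=3k$ with $k\in\mathbb{N}$, Simpson's $3/8$ rule is $$\mathcal{S}_{n}^{\frac{3}{8}}(f)=\frac{3(b-a)}{8n}\sum_{i=1}^{n/3}\Big[f(x_{3i-3})+3f(x_{3i-2})+3f(x_{3i-1})+f(x_{3i})\Big].$$ *)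

(* Defs.v *)
From HB Require Import structures.
From mathcomp Require Import all_boot all_order all_algebra.
From mathcomp Require Import all_classical all_reals all_analysis.

Set Implicit Arguments.
Unset Strict Implicit.
Unset Printing Implicit Defensive.

Import Order.TTheory GRing.Theory Num.Theory.
Import numFieldNormedType.Exports.

Local Open Scope classical_set_scope.
Local Open Scope ring_scope.

(* Functions on [a, b] and on [0, b - a] are represented by total functions
   R -> R; only their values on these intervals are ever constrained or used. *)

Definition error_function (R : realType) (a b : R) (Phi : R -> R) : Prop :=
  forall t : R, t \in `[0, b - a] -> 0 <= Phi t.

Definition Phi_monotone (R : realType) (a b : R) (Phi f : R -> R) : Prop :=
  forall x y : R, x \in `[a, b] -> y \in `[a, b] -> x < y ->
    f x <= f y + Phi (y - x).

Definition node (R : realType) (a b : R) (n i : nat) : R :=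
  a + (b - a) * i%:R / n%:R.

(* The index i starts at 1, so the truncated subtractions are exact. *)
Definition simpson38 (R : realType) (a b : R) (n : nat) (f : R -> R) : R :=
  3 * (b - a) / (8 * n%:R) *
  \sum_(1 <= i < (n %/ 3).+1)
    (f (node a b n (3 * i - 3)) + 3 * f (node a b n (3 * i - 2))
     + 3 * f (node a b n (3 * i - 1)) + f (node a b n (3 * i))).

(* Main.v *)
Require Import Defs.
From HB Require Import structures.
From mathcomp Require Import all_boot all_order all_algebra.
From mathcomp Require Import all_classical all_reals all_analysis.
From mathcomp Require Import ring lra zify.

(** Chaining the inequality [f x <= f y + Phi (y - x)] along consecutive nodes
loses [c = Phi ((b - a) / n)] per step, so the value at the [j]-th node is
squeezed between two affine functions of [j] with the same slope:
  [f a - j c <= f (x_j) <= f b + (n - j) c]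
([node_lower_bound], [node_upper_bound], both from [chain_le]).  The rule has
positive weights, hence is monotone in the node values ([sum38_le]), and it is
exact on affine functions ([sum38_affine]).  On an affine function of [j] its
normalized value is the value at the midpoint [j = n / 2], and at that point the
two bounds are [f a - (n / 2) c] and [f b + (n / 2) c]. *)

Set Implicit Arguments.
Unset Strict Implicit.
Unset Printing Implicit Defensive.

Import Order.TTheory GRing.Theory Num.Theory.
Import numFieldNormedType.Exports.

Local Open Scope classical_set_scope.
Local Open Scope ring_scope.

(** The unnormalized rule on an abstract sequence of node values, so that it can
be evaluated on comparison sequences that do not come from a function on
[[a, b]]. *)
Definition sum38 (R : realType) (k : nat) (g : nat -> R) : R :=
  \sum_(1 <= i < k.+1)
    (g (3 * i - 3)%N + 3 * g (3 * i - 2)%N + 3 * g (3 * i - 1)%N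
     + g (3 * i)%N).

Lemma sum38_le (R : realType) (k : nat) (g h : nat -> R) :
  (forall j, (j <= 3 * k)%N -> g j <= h j) -> sum38 k g <= sum38 k h.
Proof.
move=> gh; rewrite /sum38; apply: ler_sum_nat => i /andP[i1 ik].
have h0 : g (3 * i - 3)%N <= h (3 * i - 3)%N by apply: gh; lia.
have h1 : g (3 * i - 2)%N <= h (3 * i - 2)%N by apply: gh; lia.
have h2 : g (3 * i - 1)%N <= h (3 * i - 1)%N by apply: gh; lia.
have h3 : g (3 * i)%N <= h (3 * i)%N by apply: gh; lia.
lra.
Qed.

(** The weights of each panel total 8 and are symmetric about its centre, so
panel [i] contributes [8 u + (24 i - 12) v]; the odd multiples of 12 add up to
[12 k ^ 2]. *)
Lemma sum38_affine (R : realType) (k : nat) (u v : R) :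
  sum38 k (fun j => u + j%:R * v) = 8 * k%:R * u + 12 * k%:R ^+ 2 * v.
Proof.
rewrite /sum38; elim: k => [|k IHk]; first by rewrite big_geq //; ring.
rewrite big_nat_recr //= IHk.
have -> : (3 * k.+1 - 3 = 3 * k)%N by lia.
have -> : (3 * k.+1 - 2 = 3 * k + 1)%N by lia.
have -> : (3 * k.+1 - 1 = 3 * k + 2)%N by lia.
rewrite !(natrD, natrM, natr1, mulrS); ring.
Qed.

Lemma chain_le (R : realType) (n : nat) (g : nat -> R) (c : R) :
  (forall j, (j < n)%N -> g j <= g j.+1 + c) ->
  forall i d, (i + d <= n)%N -> g i <= g (i + d)%N + d%:R * c.
Proof.
move=> step i; elim=> [|d IHd] idn; first by rewrite addn0 mul0r addr0.
rewrite addnS in idn *.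
have := step _ idn; have := IHd (ltnW idn); rewrite -natr1; lra.
Qed.

Section Nodes.
Variables (R : realType) (a b : R) (Phi f : R -> R) (n : nat).
Hypotheses (hab : a < b) (n_gt0 : (0 < n)%N) (hmono : Phi_monotone a b Phi f).

Let nR_gt0 : 0 < n%:R :> R. Proof. by rewrite ltr0n. Qed.

Lemma node0 : node a b n 0 = a.
Proof. by rewrite /node mulr0 mul0r addr0. Qed.

Lemma node_last : node a b n n = b.
Proof. by rewrite /node mulfK ?gt_eqF// addrC subrK. Qed.

Lemma node_in j : (j <= n)%N -> node a b n j \in `[a, b].
Proof.
move=> jn; rewrite in_itv /= /node lerDl -lerBrDl ler_pdivrMr //.
have ba : 0 <= b - a by rewrite subr_ge0 ltW.
by rewrite divr_ge0 ?mulr_ge0 //= ler_wpM2l // ler_nat.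
Qed.

Lemma node_step j : node a b n j.+1 - node a b n j = (b - a) / n%:R.
Proof. by rewrite /node -natr1; field; rewrite gt_eqF. Qed.

Lemma node_value_step j : (j < n)%N ->
  f (node a b n j) <= f (node a b n j.+1) + Phi ((b - a) / n%:R).
Proof.
move=> jn; rewrite -(node_step j); apply: hmono; rewrite ?node_in // 1?ltnW //.
by rewrite -subr_gt0 node_step divr_gt0 // subr_gt0.
Qed.

Lemma node_lower_bound j : (j <= n)%N ->
  f a + j%:R * - Phi ((b - a) / n%:R) <= f (node a b n j).
Proof.
move=> jn; have := chain_le node_value_step (i := 0) jn.
rewrite add0n node0; lra.
Qed.

Lemma node_upper_bound j : (j <= n)%N ->
  f (node a b n j) <=
  f b + n%:R * Phi ((b - a) / n%:R) + j%:R * - Phi ((b - a) / n%:R).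
Proof.
move=> jn; have := chain_le node_value_step (i := j) (d := n - j).
rewrite subnKC // => /(_ (leqnn n)); rewrite node_last natrB //; lra.
Qed.

Lemma simpson38_mean k : n = (3 * k)%N ->
  1 / (b - a) * simpson38 a b n f =
  sum38 k (fun j => f (node a b n j)) / (8 * k%:R).
Proof.
move=> nk; have k0 : k%:R != 0 :> R by rewrite pnatr_eq0; lia.
have ba0 : b - a != 0 by rewrite subr_eq0 gt_eqF.
have nk3 : (n %/ 3 = k)%N by lia.
rewrite /simpson38 nk3 -/(sum38 k (fun j => f (node a b n j))).
have -> : n%:R = 3 * k%:R :> R by rewrite nk natrM.
by field; rewrite k0 ba0.
Qed.

End Nodes.

Theorem theorem3 (R : realType) (a b : R) (hab : a < b)
    (Phi : R -> R) (hPhi : error_function a b Phi)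
    (f : R -> R) (hcont : {within `[a, b], continuous f})
    (hmono : Phi_monotone a b Phi f)
    (n : nat) (hn0 : (0 < n)%N) (hn3 : (3 %| n)%N) :
  f a - n%:R / 2 * Phi ((b - a) / n%:R) <= 1 / (b - a) * simpson38 a b n f /\
  1 / (b - a) * simpson38 a b n f <= f b + n%:R / 2 * Phi ((b - a) / n%:R).
Proof.
have [k nk] : exists k, n = (3 * k)%N by exists (n %/ 3)%N; lia.
have k_gt0 : 0 < 8 * k%:R :> R by rewrite mulr_gt0 // ltr0n; lia.
have nkR : n%:R = 3 * k%:R :> R by rewrite nk natrM.
rewrite (simpson38_mean f hab hn0 nk).
split; [rewrite ler_pdivlMr // | rewrite ler_pdivrMr //].
- have := sum38_le (k := k) (fun j jk => node_lower_bound hab hn0 hmono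
    (eq_ind_r (fun m => (j <= m)%N) jk nk)).
  rewrite sum38_affine => /(le_trans _); apply; rewrite nkR; lra.
- have := sum38_le (k := k) (fun j jk => node_upper_bound hab hn0 hmono
    (eq_ind_r (fun m => (j <= m)%N) jk nk)).
  rewrite sum38_affine => /le_trans; apply; rewrite nkR; lra.
Qed.
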